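(* Let $h \ge p \ge 1$ and $m, k \ge 2$ be integers. Then, for $T = T_{m,k}$ (with $k \ge 4$), $T = T_{m,\infty}$, $T=\hat{T}_{m,k}$ or $T=\hat{T}_{m,\infty}$, $$\lambda_{h,p,p}(T) = \lambda^*_{h,p,p}(T) = h+2mp.$$ In addition, $$\lambda_{h,p,p}(T_{m,2}) = \lambda^*_{h,p,p}(T_{m,2}) = h+(2m-1)p,$$ $$\lambda_{h,p,p}(T_{m,3}) = \lambda^*_{h,p,p}(T_{m,3}) = \max\{h + (2m-1)p,\ (2m+1)p\}.$$
   Context: $N(u)$ is the neighbourhood of $u$ and $d(u,v)$ the distance between $u$ and $v$. An $L(h_1,h_2,h_3)$-labelling of a (finite or countably infinite) graph $G$ with span $\ell$ ($\ell$ a positive integer) is a mapping $f: V(G)\to\{0,1,\ldots,\ell\}$ such that for $i=1,2,3$ and any $u,v\in V(G)$ with $d(u,v)=i$ we have $|f(u)-f(v)|\ge h_i$. $\lambda_{h_1,h_2,h_3}(G)$ is the minimum span of such a labelling. An interval modulo $n$ is a set of the form $\{a \bmod n, (a+1) \bmod n, \ldots, b \bmod n\}$ (going cyclically from $a$ to $b$). An $L(h_1,h_2,h_3)$-labelling $f$ with span $\ell$ is elegant if for every vertex $u$ there is an interval $I_u$ modulo $\ell+1$ such that $f(N(u))\subseteq I_u$, and for every edge $uv$, $I_u\cap I_v=\emptyset$. $\lambda^*_{h_1,h_2,h_3}(G)$ is the minimum $\ell$ such that $G$ admits an elegant $L(h_1,h_2,h_3)$-labelling with span $\ell$ ($\infty$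 if none exists). $T_{m,k}$ is the complete $m$-ary tree of height $k$: the rooted tree in which every non-leaf vertex has exactly $m$ children and all leaves are at level (distance from the root) $k$. $T_{m,\infty}$ is the infinite complete $m$-ary tree: the rooted tree with countably infinitely many vertices in which every vertex (including the root) has exactly $m$ children. $\hat{T}_{m,\infty}$ is the infinite $(m+1)$-regular tree, and $\hat{T}_{m,k}$ is its finite subtree induced by all vertices at distance at most $k$ from a fixed vertex. *)

(* Defs.v *)
From HB Require Import structures.
From mathcomp Require Import all_boot all_order all_algebra.
From mathcomp Require Import boolp.

Set Implicit Arguments.
Unset Strict Implicit.
Unset Printing Implicit Defensive.

(* [countType] covers exactly the finite and the countably infinite graphs. *)
Record sgraph := SGraph {
  vertex :> countType;
  adj : rel vertex;
  adj_sym : symmetric adj;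
  adj_irr : irreflexive adj }.

(* [d(u, v) = n]; vertices in different components satisfy this for no [n]. *)
Definition is_dist (G : sgraph) (u v : G) (n : nat) : Prop :=
  (exists2 s : seq G, path (@adj G) u s /\ last u s = v & size s = n) /\
  (forall s : seq G, path (@adj G) u s -> last u s = v -> n <= size s).

Definition is_labelling (h1 h2 h3 : nat) (G : sgraph) (l : nat)
    (f : G -> 'I_l.+1) : Prop :=
  forall u v : G,
    [/\ is_dist u v 1 -> h1 <= `|(f u : int) - (f v : int)|%N,
        is_dist u v 2 -> h2 <= `|(f u : int) - (f v : int)|%N &
        is_dist u v 3 -> h3 <= `|(f u : int) - (f v : int)|%N].

(* Every cyclic run from [a] to [b] modulo [n] is of this form after adding a
   multiple of [n] to [b], so nothing is lost by assuming [a <= b]. *)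
Definition is_interval_mod (n : nat) (S : {set 'I_n}) : Prop :=
  exists a b : nat, a <= b /\
    S = [set x : 'I_n | (x : nat) \in [seq c %% n | c <- index_iota a b.+1]].

Definition is_elegant (G : sgraph) (l : nat) (f : G -> 'I_l.+1) : Prop :=
  exists I : G -> {set 'I_l.+1},
    [/\ forall u, is_interval_mod (I u),
        forall u v, adj u v -> f v \in I u &
        forall u v, adj u v -> I u :&: I v = set0].

(* The minimum of a set of naturals; [None] stands for infinity. *)
Definition min_nat (P : nat -> Prop) : option nat :=
  match pselect (exists n, `[< P n >]) with
  | left exP => Some (ex_minn exP)
  | right _ => None
  end.

Lemma min_natP (P : nat -> Prop) (n : nat) :
  min_nat P = Some n <-> P n /\ (forall l, P l -> n <= l).
Proof.
rewrite /min_nat; case: pselect => [exP|nexP]; split.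
- case: ex_minnP => k /asboolP Pk kmin [<-]; split=> // l Pl.
  by apply: kmin; apply/asboolP.
- case=> Pn nmin; case: ex_minnP => k /asboolP Pk kmin; congr Some.
  by apply/eqP; rewrite eqn_leq nmin // kmin //; apply/asboolP.
- by [].
- by case=> Pn _; case: nexP; exists n; apply/asboolP.
Qed.

Definition lambda (h1 h2 h3 : nat) (G : sgraph) : option nat :=
  min_nat (fun l => 0 < l /\
    exists f : G -> 'I_l.+1, is_labelling h1 h2 h3 f).

Definition lambda_star (h1 h2 h3 : nat) (G : sgraph) : option nat :=
  min_nat (fun l => 0 < l /\
    exists f : G -> 'I_l.+1, is_labelling h1 h2 h3 f /\ is_elegant f).

Section Induced.
Variables (G : sgraph) (P : pred G).

Definition induced_adj : rel {x : G | P x} := fun u v => adj (val u) (val v).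

Lemma induced_adj_sym : symmetric induced_adj.
Proof. by move=> u v; apply: adj_sym. Qed.

Lemma induced_adj_irr : irreflexive induced_adj.
Proof. by move=> u; apply: adj_irr. Qed.

Definition induced : sgraph := SGraph induced_adj_sym induced_adj_irr.
End Induced.

Definition ball (G : sgraph) (x : G) (k : nat) : sgraph :=
  induced (fun y : G => `[< exists2 n, n <= k & is_dist x y n >]).

(* A vertex of a rooted tree is the word of choices leading to it from the root
   [[::]], most recent choice first: the children of [w] are the [a :: w], and
   [size w] is the level of [w]. *)
Section WordTree.
Variable A : countType.

Definition is_child (u v : seq A) : bool := (v != [::]) && (behead v == u).

Definition word_adj : rel (seq A) := fun u v => is_child u v || is_child v u.

Lemma word_adj_sym : symmetric word_adj.
Proof. by move=> u v; rewrite /word_adj orbC. Qed.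

Lemma word_adj_irr : irreflexive word_adj.
Proof.
move=> [|a u] //; rewrite /word_adj /is_child orbb /=.
by apply/eqP => /(congr1 size) /= /n_Sn.
Qed.

Definition word_tree : sgraph := SGraph word_adj_sym word_adj_irr.
End WordTree.

Definition T_inf (m : nat) : sgraph := word_tree 'I_m.

Definition T (m k : nat) : sgraph :=
  induced (fun w : T_inf m => size (w : seq 'I_m) <= k).

(* Words over [m + 1] letters without two equal consecutive letters: the root
   has [m + 1] children and every other vertex has [m] children and a parent,
   so this is the [(m + 1)]-regular tree. *)
Definition That_inf (m : nat) : sgraph :=
  induced (fun w : word_tree 'I_m.+1 =>
    sorted (fun a b => a != b) (w : seq 'I_m.+1)).

Definition That (m : nat) (x : That_inf m) (k : nat) : sgraph := ball x k.

(* Main.v *)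
Require Import Defs.
From mathcomp Require Import all_boot all_order all_algebra.
From mathcomp Require Import boolp zify.

Set Implicit Arguments.
Unset Strict Implicit.
Unset Printing Implicit Defensive.

(** The lower and the upper bounds are independent of each other.

Lower bounds. For an edge [uv] the vertices of [N(u)] and [N(v)] are pairwise
within distance three, so in a labelling their labels are pairwise at least [p]
apart; counting them gives [(2m + 1)p] when both ends have degree [m + 1]
([span_ge_edge]). To make [h] appear, fix a vertex [r] and consider, among the
neighbours of [r] labelled above [r], the one, [b], of least label (if there is
none, reverse the labelling). In the labels of [N(r)] and [N(b)] the label preceding that of [b] cannot belong
to a neighbour of [r], by the choice of [b], unless it is below [r] itself;
hence all labels below [b] are at least [h] below it, and one of the gaps of
length [p] in the count is replaced by a gap of length [h] ([span_ge_star]).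
This gives [h + (d + e - 2)p] when [r] has degree [d] and all its neighbours
have degree at least [e]: [d = e = m + 1] in the large trees, and [d = m],
[e = m + 1] at the root of an [m]-ary tree of height two or three.

Upper bounds. A tree is bipartite. If [c] is a vertex colouring by [0, ..., m]
which is injective on every neighbourhood, label the even side by [c(u) p] and
the odd side by [D + c(u) p] for a suitable offset [D]. Vertices at distance two
are separated by the colouring, vertices at odd distance by the offset, and the
labelling is elegant because the labels of the two sides lie in two disjoint
intervals, one of which contains each neighbourhood
([elegant_labelling_of_blocks]). The offset [D = h + mp] always works. In the
[m]-ary trees of small height it can be lowered by [p], because there the colour
[m] on the even side and the colour [0] on the odd side can be kept from meeting
on an edge: the root takes colour [m], its children avoid [0], and the second
level avoids [m] ([mary_colour_edge]). In height three a
vertex of the even side coloured [m] and one of the odd side coloured [0] may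
still exist, at distance three; keeping them [p] apart forces the offset to be
computed with [max(h, 2p)] in place of [h]. *)

(** * Distances and separation of labels *)

Lemma is_dist_of_path (G : sgraph) (u v : G) (s : seq G) :
  path (@adj G) u s -> last u s = v -> exists2 n, n <= size s & is_dist u v n.
Proof.
move=> pu lu.
pose P n := `[< exists2 s : seq G, path (@adj G) u s /\ last u s = v & size s = n >].
have exP : exists n, P n by exists (size s); apply/asboolP; exists s.
have Pmin s' : path (@adj G) u s' -> last u s' = v -> ex_minn exP <= size s'.
  by move=> pu' lu'; case: ex_minnP => n _; apply; apply/asboolP; exists s'.
exists (ex_minn exP); first exact: Pmin.
by split=> //; case: ex_minnP => n /asboolP.
Qed.

Lemma is_dist1 (G : sgraph) (u v : G) : adj u v -> is_dist u v 1.
Proof.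
move=> uv; split; first by exists [:: v] => //=; rewrite uv.
by case=> //= _ vu; rewrite -vu adj_irr in uv.
Qed.

Lemma is_dist1_adj (G : sgraph) (u v : G) : is_dist u v 1 -> adj u v.
Proof. by case=> -[[|w [|? ?]] //= [/andP[uw _] <-]]. Qed.

Lemma is_dist2_common (G : sgraph) (u v : G) :
  is_dist u v 2 -> u != v /\ exists2 w, adj w u & adj w v.
Proof.
case=> -[[|w [|w' [|? ?]]] //= [/and3P[uw wv _] <-] _] dmin; split.
  by apply/eqP => /(dmin [::] isT).
by exists w; rewrite // adj_sym.
Qed.

Lemma is_dist3_path (G : sgraph) (u v : G) :
  is_dist u v 3 -> exists w w', [/\ adj u w, adj w w' & adj w' v].
Proof.
case=> -[[|w [|w' [|w'' [|? ?]]]] //= [/and4P[uw ww wv _] <-] _] _.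
by exists w, w'.
Qed.

Lemma labelling_adj h p l (G : sgraph) (f : G -> 'I_l.+1) (u v : G) :
  is_labelling h p p f -> adj u v -> h <= `|(f u : int) - (f v : int)|%N.
Proof. by move=> fP uv; case: (fP u v) => + _ _; apply; apply: is_dist1. Qed.

(** The minimal length of a walk decides which of the three conditions applies;
since [p <= h], each of them separates by [p]. Lower bounds can thus be obtained
by exhibiting walks, without computing distances. *)
Lemma labelling_path h p l (G : sgraph) (f : G -> 'I_l.+1) (u v : G) (s : seq G) :
  p <= h -> is_labelling h p p f -> path (@adj G) u s -> last u s = v ->
  size s <= 3 -> u != v -> p <= `|(f u : int) - (f v : int)|%N.
Proof.
move=> ph fP pu lu s3 uv; have [n ns dn] := is_dist_of_path pu lu.
have [f1 f2 f3] := fP u v; case: n ns dn => [|[|[|[|n]]]] ns dn.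
- by case: dn uv => -[[|? ?] //= [_ ->]]; rewrite eqxx.
- exact: leq_trans ph (f1 dn).
- exact: f2.
- exact: f3.
- by lia.
Qed.

(** * Packing separated labels *)

Section Packing.
Variables (V : eqType) (p : nat).
Hypothesis p_gt0 : 0 < p.

(** Quotients by [p] of labels at least [p] apart are distinct. Adding [p] on the
right avoids the truncated subtraction in [(size vs - 1) * p <= N]. *)
Lemma packing (F : V -> nat) (vs : seq V) N :
    uniq vs -> {in vs &, forall u v, u != v -> p <= `|(F u : int) - (F v : int)|%N} ->
    {in vs, forall u, F u <= N} ->
  size vs * p <= N + p.
Proof.
move=> uvs sep bnd.
have uq : uniq [seq F u %/ p | u <- vs].
  rewrite map_inj_in_uniq // => u v us vs' e; apply/eqP/negPn/negP => /(sep u v us vs').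
  have := divn_eq (F u) p; have := divn_eq (F v) p; rewrite e.
  have := ltn_pmod (F u) p_gt0; have := ltn_pmod (F v) p_gt0.
  lia.
have /(uniq_leq_size uq) : {subset [seq F u %/ p | u <- vs] <= iota 0 (N %/ p).+1}.
  move=> _ /mapP[u us ->]; rewrite mem_iota /= add0n ltnS.
  by apply: leq_div2r; apply: bnd.
rewrite size_map size_iota -(leq_pmul2r p_gt0) mulSn => /leq_trans; apply.
by rewrite addnC leq_add2r leq_divM.
Qed.

(** The labels below [b] are packed in [0, F b - h] and the others in [F b, l];
each of the two packings loses one [p]. *)
Lemma packing_gap (F : V -> nat) (vs : seq V) (b : V) h l :
    uniq vs -> {in vs &, forall u v, u != v -> p <= `|(F u : int) - (F v : int)|%N} ->
    {in vs, forall u, F u <= l} -> F b <= l -> h <= F b ->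
    {in vs, forall u, F u < F b -> F u + h <= F b} ->
  h + size vs * p <= l + 2 * p.
Proof.
move=> uvs sep bnd bl hb gap.
have low : size [seq u <- vs | F u < F b] * p <= F b - h + p.
  apply: (@packing F); first exact: filter_uniq.
    by move=> u v; rewrite !mem_filter => /andP[_ us] /andP[_ vs']; apply: sep.
  by move=> u; rewrite mem_filter => /andP[ub us]; have := gap u us ub; lia.
have high : size [seq u <- vs | ~~ (F u < F b)] * p <= l - F b + p.
  apply: (@packing (fun u => F u - F b)); first exact: filter_uniq.
    move=> u v; rewrite !mem_filter => /andP[ub us] /andP[vb vs'] uv.
    by have := sep u v us vs' uv; lia.
  by move=> u; rewrite mem_filter => /andP[ub us]; have := bnd u us; lia.
have -> : size vs = size [seq u <- vs | F u < F b] + size [seq u <- vs | ~~ (F u < F b)].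
  by rewrite !size_filter; exact/esym/count_predC.
by rewrite mulnDl; lia.
Qed.

End Packing.

(** * Lower bounds on the span *)

Definition degree_ge (G : sgraph) (n : nat) (u : G) : Prop :=
  exists s : seq G, [/\ uniq s, all (adj u) s & n <= size s].

Definition bipartition (G : sgraph) (side : G -> bool) : Prop :=
  forall u v, adj u v -> side v = ~~ side u.

Lemma edge_neighbours_uniq (G : sgraph) (side : G -> bool) (u v : G) (s t : seq G) :
    bipartition side -> adj u v -> uniq s -> all (adj u) s ->
    uniq t -> all (adj v) t -> uniq (s ++ t).
Proof.
move=> bip uv us /allP us' ut /allP vt; rewrite cat_uniq us ut andbT /=.
apply/hasPn => x /vt vx; apply/negP => /us' ux.
by have := bip _ _ vx; rewrite (bip _ _ ux) (bip _ _ uv); case: (side u).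
Qed.

Section LowerBounds.
Variables (h p l : nat) (G : sgraph) (side : G -> bool).
Hypotheses (p_gt0 : 0 < p) (ph : p <= h) (bip : bipartition side).

Lemma edge_neighbours_sep (f : G -> 'I_l.+1) (u v : G) (s t : seq G) :
    is_labelling h p p f -> adj u v -> all (adj u) s -> all (adj v) t ->
  {in s ++ t &, forall x y, x != y -> p <= `|(f x : int) - (f y : int)|%N}.
Proof.
move=> fP uv /allP us /allP vt x y.
rewrite !mem_cat => /orP[/us ux|/vt vx] /orP[/us uy|/vt vy].
- by apply: (@labelling_path _ _ _ _ _ _ _ [:: u; y] ph fP) => //=; rewrite adj_sym ux uy.
- by apply: (@labelling_path _ _ _ _ _ _ _ [:: u; v; y] ph fP) => //=;
  rewrite adj_sym ux uv vy.
- by apply: (@labelling_path _ _ _ _ _ _ _ [:: v; u; y] ph fP) => //=;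
  rewrite adj_sym vx adj_sym uv uy.
- by apply: (@labelling_path _ _ _ _ _ _ _ [:: v; y] ph fP) => //=; rewrite adj_sym vx vy.
Qed.

Lemma span_ge_edge (f : G -> 'I_l.+1) (u v : G) d e :
    is_labelling h p p f -> adj u v -> degree_ge d u -> degree_ge e v ->
  (d + e) * p <= l + p.
Proof.
move=> fP uv [s [us su ds]] [t [ut tv et]].
apply: (@leq_trans (size (s ++ t) * p)).
  by rewrite leq_mul2r size_cat leq_add ?orbT.
apply: (packing p_gt0 (F := fun x => f x : nat)).
- exact: edge_neighbours_uniq bip uv us su ut tv.
- exact: edge_neighbours_sep fP uv su tv.
- by move=> x _; rewrite -ltnS.
Qed.

(** The case of [span_ge_star] in which some neighbour is labelled above [r]. *)
Lemma span_ge_star_above (f : G -> 'I_l.+1) (r : G) (s : seq G) e :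
    is_labelling h p p f -> uniq s -> all (adj r) s -> has (fun c => f r < f c) s ->
    {in s, forall c, degree_ge e c} ->
  h + (size s + e) * p <= l + 2 * p.
Proof.
move=> fP us sr /hasP[c0 c0s c0r] deg.
pose Q n := has (fun c => (f r < f c) && (f c == n :> nat)) s.
have exQ : exists n, Q n by exists (f c0); apply/hasP; exists c0; rewrite ?c0r ?eqxx.
case: (ex_minnP exQ) => n /hasP[b bs /andP[rb /eqP <-]] bmin.
(* [b] has the least label among the neighbours of [r] labelled above [r] *)
have adj_rb : adj r b := allP sr b bs.
have [t [ut tb et]] := deg b bs.
apply: (@leq_trans (h + size (s ++ t) * p)).
  by rewrite leq_add2l leq_mul2r size_cat leq_add ?orbT.
have fb := labelling_adj fP adj_rb.
apply: (packing_gap p_gt0 (F := fun x => f x : nat) (b := b)).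
- exact: edge_neighbours_uniq bip adj_rb us sr ut tb.
- exact: edge_neighbours_sep fP adj_rb sr tb.
- by move=> x _; rewrite -ltnS.
- by rewrite -ltnS.
- by lia.
move=> x; rewrite mem_cat => /orP[xs|xt] xb.
  (* by the choice of [b], [x] is labelled below [r], hence at least [h] below [b] *)
  have : ~~ (f r < f x).
    apply/negP => rx; have : Q (f x) by apply/hasP; exists x; rewrite ?rx ?eqxx.
    by move/bmin; rewrite leqNgt xb.
  by lia.
by have := labelling_adj fP (allP tb x xt); lia.
Qed.

Lemma labelling_rev (f : G -> 'I_l.+1) :
  is_labelling h p p f -> is_labelling h p p (fun u => rev_ord (f u)).
Proof.
move=> fP u v; have [f1 f2 f3] := fP u v.
have e : `|(rev_ord (f u) : int) - (rev_ord (f v) : int)|%N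
       = `|(f u : int) - (f v : int)|%N.
  by rewrite /=; have := ltn_ord (f u); have := ltn_ord (f v); lia.
by split; rewrite e.
Qed.

(** If every neighbour of [r] is labelled below [r], the reversed labelling puts
one above. *)
Lemma span_ge_star (f : G -> 'I_l.+1) (r : G) d e :
    is_labelling h p p f -> 0 < d -> degree_ge d r ->
    (forall c, adj r c -> degree_ge e c) ->
  h + (d + e) * p <= l + 2 * p.
Proof.
move=> fP d_gt0 [s [us sr ds]] deg.
apply: (@leq_trans (h + (size s + e) * p)).
  by rewrite leq_add2l leq_mul2r leq_add2r ds orbT.
have degs : {in s, forall c, degree_ge e c} by move=> c /(allP sr); apply: deg.
have [above|below] := boolP (has (fun c => f r < f c) s).
  exact: span_ge_star_above fP us sr above degs.
apply: (span_ge_star_above (labelling_rev fP) us sr _ degs).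
case: s ds sr below {us} degs => [/(leq_trans d_gt0)//|c s _ /= /andP[rc _]].
have := labelling_adj fP rc; rewrite negb_or => + /andP[+ _] _.
by have := ltn_ord (f r); have := ltn_ord (f c); lia.
Qed.

End LowerBounds.

(** * Elegant labellings in two blocks *)

Lemma is_interval_mod_itv n a b :
  a <= b < n -> is_interval_mod [set x : 'I_n | a <= x <= b].
Proof.
move=> /andP[ab bn]; exists a, b; split=> //; apply/setP => x; rewrite !inE.
apply/idP/mapP => [axb|[c]].
  by exists (x : nat); rewrite ?mem_index_iota ?ltnS // modn_small.
by rewrite mem_index_iota ltnS => /andP[ac cb] ->; rewrite modn_small ?ac //; lia.
Qed.

(** The even side is labelled in [0, t - p], the odd side in [t, l]; the threshold
[t] is what separates vertices at distance three, and its two sides are the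
intervals required by elegance. The separation by [h] along edges is the
independent condition [far]. *)
Section Blocks.
Variables (h p D t l : nat) (G : sgraph) (side : G -> bool) (c : G -> nat).
Hypotheses (p_gt0 : 0 < p) (tl : 0 < t <= l) (bip : bipartition side).
Hypothesis c_inj : forall w u v, adj w u -> adj w v -> u != v -> c u != c v.
Hypothesis low : forall u, ~~ side u -> (c u).+1 * p <= t.
Hypothesis high : forall u, side u -> t <= D + c u * p <= l.
Hypothesis far : forall u v, adj u v -> side v -> c u * p + h <= D + c v * p.

Definition block_label (u : G) : 'I_l.+1 :=
  inord ((if side u then D else 0) + c u * p).

Lemma block_labelE u :
  block_label u = (if side u then D else 0) + c u * p :> nat.
Proof.
rewrite inordK // ltnS; case: (boolP (side u)) => [/high /andP[]//|/low].
by rewrite mulSn; lia.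
Qed.

Lemma block_label_side u :
  if side u then t <= block_label u else block_label u + p <= t.
Proof.
rewrite block_labelE; case: (boolP (side u)) => [/high /andP[]//|/low].
by rewrite mulSn; lia.
Qed.

Lemma block_labelling : is_labelling h p p block_label.
Proof.
move=> u v; split.
- move=> /is_dist1_adj uv; have e := bip uv; rewrite !block_labelE e.
  case: (boolP (side u)) e => su e /=.
    by have := far (etrans (adj_sym v u) uv) su; lia.
  by have := far uv e; lia.
- move=> /is_dist2_common[uv [w wu wv]]; have := c_inj wu wv uv.
  rewrite !block_labelE (bip wu) (bip wv); move: (if _ then _ else _) => o.
  by rewrite neq_ltn => /orP[]; nia.
- move=> /is_dist3_path[w [w' [uw ww wv]]].
  have := block_label_side u; have := block_label_side v.
  by rewrite (bip wv) (bip ww) (bip uw); case: (side u) => /=; lia.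
Qed.

Lemma block_elegant : is_elegant block_label.
Proof.
exists (fun u => if side u then [set x : 'I_l.+1 | 0 <= x <= t.-1]
                 else [set x : 'I_l.+1 | t <= x <= l]); split.
- move=> u; case: ifP => _; apply: is_interval_mod_itv; lia.
- move=> u v uv; have := block_label_side v; have := ltn_ord (block_label v).
  by rewrite (bip uv); case: (side u) => /=; rewrite inE; lia.
- move=> u v /bip ->; apply/setP => x.
  by case: (side u) => /=; rewrite !inE; apply/negbTE; lia.
Qed.

Lemma elegant_labelling_of_blocks :
  exists f : G -> 'I_l.+1, is_labelling h p p f /\ is_elegant f.
Proof. by exists block_label; split; [exact: block_labelling | exact: block_elegant]. Qed.

End Blocks.

(** * Reduction to bounds and degrees in subgraphs *)

Lemma lambdaP h1 h2 h3 (G : sgraph) L :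
    0 < L -> (exists f : G -> 'I_L.+1, is_labelling h1 h2 h3 f /\ is_elegant f) ->
    (forall l (f : G -> 'I_l.+1), is_labelling h1 h2 h3 f -> L <= l) ->
  lambda h1 h2 h3 G = Some L /\ lambda_star h1 h2 h3 G = Some L.
Proof.
move=> L_gt0 [f [fP fE]] min; split; apply/min_natP; split.
- by split=> //; exists f.
- by move=> l [_ [g gP]]; apply: min gP.
- by split=> //; exists f.
- by move=> l [_ [g [gP _]]]; apply: min gP.
Qed.

Lemma degree_ge_induced (G : sgraph) (P : pred G) (u : induced P) n :
    (exists s : seq G, [/\ uniq s, all (adj (val u)) s, all P s & n <= size s]) ->
  degree_ge n u.
Proof.
move=> [s [us su sP ns]]; exists (pmap insub s); split.
- exact: pmap_sub_uniq.
- apply/allP => v; rewrite mem_pmap_sub => vs; exact: (allP su _ vs).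
- by rewrite size_pmap_sub (eqP (_ : count P s == size s)) // -all_count.
Qed.

(** A vertex strictly inside a ball keeps all its neighbours. *)
Lemma ball_degree (G : sgraph) (x : G) k d (y : ball x k) n :
  is_dist x (val y) n -> n < k -> degree_ge d (val y) -> degree_ge d y.
Proof.
move=> [[s [xs sy] sn] _] nk [t [ut ty dt]].
apply: degree_ge_induced; exists t; split=> //; apply/allP => z zt; apply/asboolP.
have [|] := @is_dist_of_path _ x z (rcons s z) _ (last_rcons _ _ _).
  by rewrite rcons_path xs sy (allP ty).
move=> i; rewrite size_rcons sn => i_n xz; exists i => //; exact: leq_trans i_n nk.
Qed.

(** * The [m]-ary trees *)

Section Words.
Variable A : countType.
Implicit Types u v w : seq A.

Lemma word_adjP u v :
  reflect ((exists a, v = a :: u) \/ (exists a, u = a :: v)) (word_adj u v).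
Proof.
apply: (iffP orP); rewrite /is_child.
- by case=> /andP[]; [case: v => // a v _ /eqP <-; left; exists a
                     |case: u => // a u _ /eqP <-; right; exists a].
- by case=> -[a ->]; [left|right]; rewrite /= eqxx.
Qed.

Lemma word_bipartition : @bipartition (word_tree A) (fun w => odd (size (w : seq A))).
Proof. by move=> u v /word_adjP[] [a ->] /=; rewrite ?negbK. Qed.

End Words.

Section MaryTree.
Variable m : nat.
Implicit Types w : seq 'I_m.

Definition word_neighbours w : seq (seq 'I_m) :=
  (if w is _ :: w' then [:: w'] else [::]) ++ [seq a :: w | a <- enum 'I_m].

Lemma size_word_neighbours w : size (word_neighbours w) = m + (w != [::]).
Proof. by case: w => [|a w]; rewrite /= size_map size_enum_ord ?addn0 ?addn1. Qed.

Lemma word_neighbours_uniq w : uniq (word_neighbours w).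
Proof.
have us : uniq [seq a :: w | a <- enum 'I_m].
  by rewrite map_inj_uniq ?enum_uniq // => a b [].
case: w us => [|b w] us //=; rewrite us andbT.
by apply/mapP => -[a _ /(congr1 size) /=]; lia.
Qed.

Lemma word_neighbours_adj w : all (word_adj w) (word_neighbours w).
Proof.
rewrite all_cat; apply/andP; split.
  by case: w => //= a w; rewrite andbT; apply/word_adjP; right; exists a.
by apply/allP => _ /mapP[a _ ->]; apply/word_adjP; left; exists a.
Qed.

Lemma T_inf_degree (w : T_inf m) : degree_ge (m + ((w : seq 'I_m) != [::])) w.
Proof.
exists (word_neighbours w).
by rewrite word_neighbours_uniq word_neighbours_adj size_word_neighbours.
Qed.

Lemma T_degree k (w : T m k) :
  size (val w : seq 'I_m) < k -> degree_ge (m + ((val w : seq 'I_m) != [::])) w.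
Proof.
move=> wk; apply: degree_ge_induced; exists (word_neighbours (val w)).
rewrite word_neighbours_uniq word_neighbours_adj size_word_neighbours; split=> //.
apply/allP => v /(allP (word_neighbours_adj _)) /word_adjP[] [a e]; first by rewrite e.
by move: wk; rewrite e /=; lia.
Qed.

Lemma T_inner_degree k (w : T m k) :
  0 < size (val w : seq 'I_m) < k -> degree_ge m.+1 w.
Proof.
by move=> /andP[w0 /T_degree]; rewrite -size_eq0 -lt0n w0 addn1.
Qed.

(** On each neighbourhood the children take, in increasing order, the colours that
the parent leaves free; the children of the root, which has no parent, take
[1, ..., m] instead of [0, ..., m - 1], so that the odd side avoids [0] on the
first level. With colour [m] for the root, the second level avoids [m]. *)
Fixpoint mary_colour (w : seq 'I_m) : nat :=
  match w with
  | [::] => m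
  | a :: w1 => if w1 is _ :: w2 then bump (mary_colour w2) a else a.+1
  end.

Lemma mary_colour_le w : mary_colour w <= m.
Proof.
case: w => [|a [|b w]] //=; have := ltn_ord a.
by rewrite /bump; lia.
Qed.

Lemma mary_colour_level1 w : size w = 1 -> 0 < mary_colour w.
Proof. by case: w => [|a []]. Qed.

Lemma mary_colour_level2 w : size w = 2 -> mary_colour w < m.
Proof.
by case: w => [|a [|b []]] //= _; have := ltn_ord a; rewrite /bump; lia.
Qed.

(** On the first three levels below the root no edge joins an even vertex coloured
[m] to an odd vertex coloured [0]: the former can only be the root, whose
neighbours are on the first level. *)
Lemma mary_colour_edge w v :
  word_adj w v -> odd (size v) -> size w <= 3 -> mary_colour w < m + mary_colour v.
Proof.
move=> wv ov; have := word_bipartition wv; rewrite ov.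
case sw: (size w) => [|[|[|[]]]] // _ _; last by have := mary_colour_level2 sw; lia.
have /mary_colour_level1 : size v = 1.
  by move: sw; case/word_adjP: wv => -[a ->] //= ->.
by have := mary_colour_le w; lia.
Qed.

Lemma mary_colour_inj w u v :
  word_adj w u -> word_adj w v -> u != v -> mary_colour u != mary_colour v.
Proof.
move=> /word_adjP[] [a e] /word_adjP[] [b e'].
- rewrite e e' eqseq_cons eqxx andbT.
  by case: w e e' => [|c w] _ _ /=; rewrite ?eqSS // (inj_eq (can_inj (bumpK _))).
- by rewrite e e' /= => _; rewrite eq_sym neq_bump.
- by rewrite e' e /= => _; rewrite neq_bump.
- by move: e'; rewrite e => -[_ ->]; rewrite eqxx.
Qed.

Lemma T_bipartition k : @bipartition (T m k) (fun u => odd (size (val u : seq 'I_m))).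
Proof. by move=> u v; apply: (@word_bipartition 'I_m). Qed.

Lemma T_colour_inj k (w u v : T m k) :
  adj w u -> adj w v -> u != v ->
  mary_colour (val u : seq 'I_m) != mary_colour (val v : seq 'I_m).
Proof. by move=> wu wv uv; apply: mary_colour_inj wu wv uv. Qed.

Lemma T_colour_le k (u : T m k) : mary_colour (val u : seq 'I_m) <= m.
Proof. exact: mary_colour_le. Qed.

Lemma T_root_degree k (r : T m k) :
  val r = [::] -> 2 <= k ->
  degree_ge m r /\ forall v, adj r v -> degree_ge m.+1 v.
Proof.
move=> r0 k2; split.
  by have := @T_degree k r; rewrite r0 addn0; apply; apply: ltnW.
move=> v /word_adjP[] [b e]; last by rewrite r0 in e.
by apply: T_inner_degree; rewrite e r0.
Qed.

End MaryTree.

(** * The [(m + 1)]-regular tree *)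

(** The reduced words form the Cayley graph of the free product of [m + 1] groups
of order two: [step a] is left multiplication by the generator [a]. *)
Section RegularTree.
Variable m : nat.
Implicit Types w : seq 'I_m.+1.
Local Notation reduced := (sorted (fun a b : 'I_m.+1 => a != b)).

Definition step (a : 'I_m.+1) w : seq 'I_m.+1 :=
  if w is b :: w' then if a == b then w' else a :: w else [:: a].

Lemma step_adj a w : word_adj w (step a w).
Proof.
apply/word_adjP; case: w => [|b w] /=; first by left; exists a.
by case: eqP => _; [right; exists b | left; exists a].
Qed.

Lemma step_reduced a w : reduced w -> reduced (step a w).
Proof.
case: w => [|b w] //=; case: eqP => [_ /path_sorted //|/eqP ab] /= ->.
by rewrite ab.
Qed.

Lemma step_inj w : reduced w -> injective (step ^~ w).
Proof.
move=> rw a b; case: w rw => [|c w] rw /=; first by case.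
case: (a =P c) (b =P c) => [->|_] [->|_] //.
- by move/(congr1 size) => /=; lia.
- by move/(congr1 size) => /=; lia.
- by case.
Qed.

Lemma step_onto w u : reduced w -> reduced u -> word_adj w u -> exists a, u = step a w.
Proof.
move=> rw ru /word_adjP[] [a e]; exists a; last by rewrite e /= eqxx.
by move: ru; rewrite e; case: (w) => [|b w'] //= /andP[/negbTE ->].
Qed.

(** The alternating sum of the letters, modulo [m + 1]. Then the colours at the
two ends of an edge add up to its letter, also when the edge leads back to the
parent; as the letters around a vertex are distinct, so are the colours. *)
Definition regular_colour w : 'I_m.+1 := foldr (fun a x => (a - x)%R) 0%R w.

Lemma regular_colour_step a w :
  regular_colour (step a w) = (a - regular_colour w)%R.
Proof.
case: w => [|b w] //=; case: eqP => [->|_] //=.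
by rewrite GRing.subKr.
Qed.

Lemma regular_colour_inj (w u v : That_inf m) :
  adj w u -> adj w v -> u != v -> regular_colour (val u) != regular_colour (val v).
Proof.
move=> wu wv; have [a ea] := step_onto (valP w) (valP u) wu.
have [b eb] := step_onto (valP w) (valP v) wv.
rewrite -val_eqE ea eb !regular_colour_step; apply: contraNneq.
by move/GRing.addIr ->.
Qed.

Lemma regular_degree (w : That_inf m) : degree_ge m.+1 w.
Proof.
apply: degree_ge_induced; exists [seq step a (val w) | a <- enum 'I_m.+1].
rewrite map_inj_uniq ?enum_uniq; last exact: step_inj (valP w).
rewrite size_map size_enum_ord; split=> //.
- by apply/allP => _ /mapP[a _ ->]; apply: step_adj.
- by apply/allP => _ /mapP[a _ ->]; apply: step_reduced (valP w).
Qed.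

End RegularTree.

(** * The spans *)

Section Spans.
Variables (h p m : nat).
Hypotheses (p_gt0 : 0 < p) (ph : p <= h) (m_ge2 : 2 <= m).

(** The lower bound comes from the star of [r], the upper one from the two blocks
with offset and threshold both equal to [h + mp]. *)
Lemma lambda_full (G : sgraph) (side : G -> bool) (c : G -> nat) (r : G) :
    bipartition side -> (forall u, c u <= m) ->
    (forall w u v, adj w u -> adj w v -> u != v -> c u != c v) ->
    degree_ge m.+1 r -> (forall v, adj r v -> degree_ge m.+1 v) ->
  lambda h p p G = Some (h + 2 * m * p) /\
  lambda_star h p p G = Some (h + 2 * m * p).
Proof.
move=> bip cm c_inj rdeg deg; apply: lambdaP; first by lia.
  apply: (@elegant_labelling_of_blocks h p (h + m * p) (h + m * p) _ G side c) => //.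
  - by nia.
  - by move=> u _; have := cm u; nia.
  - by move=> u _; have := cm u; nia.
  - by move=> u v _ _; have := cm u; nia.
move=> l f fP; have := span_ge_star p_gt0 ph bip fP (ltn0Sn m) rdeg deg; lia.
Qed.

Lemma lambda_T (k : nat) : 4 <= k ->
  lambda h p p (T m k) = Some (h + 2 * m * p) /\
  lambda_star h p p (T m k) = Some (h + 2 * m * p).
Proof.
move=> k4; pose a : 'I_m := Ordinal (ltnW m_ge2).
(* a vertex on the second level: neither it nor its neighbours are the root or
   leaves *)
have Pr : size [:: a; a] <= k by rewrite /=; lia.
pose r : T m k := exist _ [:: a; a] Pr.
apply: (lambda_full (r := r) (@T_bipartition m k) (@T_colour_le m k) (@T_colour_inj m k)).
- by apply: T_inner_degree => /=; lia.
- move=> v /word_adjP[] [b e]; apply: T_inner_degree; first by rewrite e /=; lia.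
  by rewrite /=; case: e => _ <- /=; lia.
Qed.

Lemma lambda_T_inf :
  lambda h p p (T_inf m) = Some (h + 2 * m * p) /\
  lambda_star h p p (T_inf m) = Some (h + 2 * m * p).
Proof.
pose a : 'I_m := Ordinal (ltnW m_ge2).
apply: (@lambda_full (T_inf m) (fun u => odd (size (u : seq 'I_m)))
          (@mary_colour m) [:: a; a]).
- exact: word_bipartition.
- by move=> u; apply: mary_colour_le.
- by move=> w u v; apply: mary_colour_inj.
- by rewrite -addn1; apply: (@T_inf_degree m [:: a; a]).
- move=> v /word_adjP[] [b e]; have := T_inf_degree v;
    last by case: e => _ <-; rewrite addn1.
  by rewrite e addn1.
Qed.

Lemma lambda_That_inf :
  lambda h p p (That_inf m) = Some (h + 2 * m * p) /\
  lambda_star h p p (That_inf m) = Some (h + 2 * m * p).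
Proof.
pose r : That_inf m := exist _ [::] isT.
apply: (@lambda_full (That_inf m) (fun u => odd (size (val u : seq 'I_m.+1)))
          (fun u => regular_colour (val u)) r).
- by move=> u v; apply: (@word_bipartition 'I_m.+1).
- by move=> u; rewrite -ltnS.
- by move=> w u v; apply: regular_colour_inj.
- exact: regular_degree.
- by move=> v _; apply: regular_degree.
Qed.

Lemma lambda_That (x : That_inf m) (k : nat) : 2 <= k ->
  lambda h p p (That x k) = Some (h + 2 * m * p) /\
  lambda_star h p p (That x k) = Some (h + 2 * m * p).
Proof.
move=> k2; have x0 : is_dist x x 0 by split=> //; exists [::].
have Px : `[< exists2 n, n <= k & is_dist x x n >] by apply/asboolP; exists 0.
pose r : That x k := exist _ x Px.
apply: (@lambda_full (That x k) (fun u => odd (size (val (val u) : seq 'I_m.+1)))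
          (fun u => regular_colour (val (val u))) r).
- by move=> u v; apply: (@word_bipartition 'I_m.+1).
- by move=> u; rewrite -ltnS.
- by move=> w u v; apply: regular_colour_inj.
- by apply: (@ball_degree _ x k _ r 0) => //; [lia | apply: regular_degree].
- move=> v rv; apply: (@ball_degree _ x k _ v 1) => //; last exact: regular_degree.
  by apply: is_dist1; exact: rv.
Qed.

(** The threshold is [h + mp] while the offset is [h + (m - 1)p]: the odd side is
the first level, where colour [0] does not occur. *)
Lemma lambda_T2 :
  lambda h p p (T m 2) = Some (h + (2 * m - 1) * p) /\
  lambda_star h p p (T m 2) = Some (h + (2 * m - 1) * p).
Proof.
have bip := @T_bipartition m 2; have c_inj := @T_colour_inj m 2.
have c_le := @T_colour_le m 2.
apply: lambdaP; first by lia.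
  have odd_gt0 (u : T m 2) : odd (size (val u : seq 'I_m)) ->
      0 < mary_colour (val u : seq 'I_m).
    move=> ou; apply: mary_colour_level1; move: (valP u) ou => /=.
    by case: (size _) => [|[|[]]].
  apply: (elegant_labelling_of_blocks (D := h + (m - 1) * p) (t := h + m * p)
    p_gt0 _ bip c_inj).
  - by nia.
  - by move=> u _; have := c_le u; nia.
  - by move=> u /odd_gt0; have := c_le u; nia.
  - by move=> u v _ /odd_gt0; have := c_le u; nia.
move=> l f fP; pose r : T m 2 := exist _ [::] isT.
have [rdeg deg] := T_root_degree (erefl : val r = [::]) isT.
have := span_ge_star p_gt0 ph bip fP (ltnW m_ge2) rdeg deg; nia.
Qed.

(** For [h < 2p] the value is that obtained for [h = 2p], and a labelling with edges
separated by [2p] is one with edges separated by [h]. The condition [2p <= H] is what makes room,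
below the threshold, for the colour [m] of the even side. *)
Lemma lambda_T3 :
  lambda h p p (T m 3) = Some (maxn (h + (2 * m - 1) * p) ((2 * m + 1) * p)) /\
  lambda_star h p p (T m 3) =
    Some (maxn (h + (2 * m - 1) * p) ((2 * m + 1) * p)).
Proof.
have bip := @T_bipartition m 3; have c_inj := @T_colour_inj m 3.
have c_le := @T_colour_le m 3.
pose H := maxn h (2 * p); pose D := H + (m - 1) * p.
have -> : maxn (h + (2 * m - 1) * p) ((2 * m + 1) * p) = H + (2 * m - 1) * p.
  by rewrite /H; nia.
have [hH pH] : h <= H /\ 2 * p <= H by rewrite /H; lia.
apply: lambdaP; first by lia.
  have edge (u v : T m 3) : adj u v -> odd (size (val v : seq 'I_m)) ->
      mary_colour (val u : seq 'I_m) < m + mary_colour (val v : seq 'I_m).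
    by move=> uv ov; apply: mary_colour_edge uv ov (valP u).
  apply: (elegant_labelling_of_blocks (D := D) (t := D) p_gt0 _ bip c_inj).
  - by rewrite /D; nia.
  - by move=> u _; have := c_le u; rewrite /D; nia.
  - by move=> u _; have := c_le u; rewrite /D; nia.
  - by move=> u v uv /(edge u v uv); rewrite /D; nia.
move=> l f fP; pose r : T m 3 := exist _ [::] isT.
have [rdeg deg] := T_root_degree (erefl : val r = [::]) isT.
(* the star of the root accounts for the term containing [h], and an edge between
   the first two levels for [(2m + 1)p] *)
have star := span_ge_star p_gt0 ph bip fP (ltnW m_ge2) rdeg deg.
pose a : 'I_m := Ordinal (ltnW m_ge2).
pose u : T m 3 := exist _ [:: a] isT; pose v : T m 3 := exist _ [:: a; a] isT.
have uv : adj u v by apply/word_adjP; left; exists a.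
have du : degree_ge m.+1 u by exact: T_inner_degree.
have dv : degree_ge m.+1 v by exact: T_inner_degree.
have := span_ge_edge p_gt0 ph bip fP uv du dv.
by rewrite /H; nia.
Qed.

End Spans.

Theorem corollary3p3 (h p m k : nat)
    (p_ge1 : 1 <= p) (h_ge_p : p <= h) (m_ge2 : 2 <= m) (k_ge2 : 2 <= k) :
  (4 <= k ->
     lambda h p p (T m k) = Some (h + 2 * m * p) /\
     lambda_star h p p (T m k) = Some (h + 2 * m * p)) /\
  (lambda h p p (T_inf m) = Some (h + 2 * m * p) /\
   lambda_star h p p (T_inf m) = Some (h + 2 * m * p)) /\
  (forall x : That_inf m,
     lambda h p p (That x k) = Some (h + 2 * m * p) /\
     lambda_star h p p (That x k) = Some (h + 2 * m * p)) /\
  (lambda h p p (That_inf m) = Some (h + 2 * m * p) /\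
   lambda_star h p p (That_inf m) = Some (h + 2 * m * p)) /\
  (lambda h p p (T m 2) = Some (h + (2 * m - 1) * p) /\
   lambda_star h p p (T m 2) = Some (h + (2 * m - 1) * p)) /\
  (lambda h p p (T m 3) = Some (maxn (h + (2 * m - 1) * p) ((2 * m + 1) * p)) /\
   lambda_star h p p (T m 3) =
     Some (maxn (h + (2 * m - 1) * p) ((2 * m + 1) * p))).
Proof.
split; first exact: lambda_T.
split; first exact: lambda_T_inf.
split; first by move=> x; apply: lambda_That.
split; first exact: lambda_That_inf.
by split; [exact: lambda_T2 | exact: lambda_T3].
Qed.
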